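(* Consider the following conditions on a $*$-homomorphism $\varphi\colon A\to\mathcal{M}(B)$ for C*-algebras $A$, $B$: (JR) joins in $\mathbb{I}(A)$ of arbitrary families of restricted ideals are restricted; (FR1) $r\circ i(I\cap J)=I\cap r\circ i(J)$ for all $I\in\mathbb{I}^B(A)$, $J\in\mathbb{I}(A)$; (MI$_{\mathrm f}$) intersections of finite (non-empty) families of induced ideals are induced. If $A\subseteq B$ is a symmetric inclusion, then (JR), (FR1) and (MI$_{\mathrm f}$) hold. If $\varphi\colon A\to\mathcal{M}(B)$ is a symmetric $*$-homomorphism, then (FR1) and (MI$_{\mathrm f}$) hold.
   Context: Ideals are closed and two-sided. For a C*-algebra $D$, $\mathbb{I}(D)$ is the complete lattice of ideals of $D$ ordered by inclusion (joins are closed linear spans, meets are intersections). $\mathcal{M}(B)$ is the multiplier algebra; products of subspaces mean closed linear spans of products. For a $*$-homomorphism $\varphi\colon A\to\mathcal{M}(B)$, define for $J\in\mathbb{I}(B)$ and $I\in\mathbb{I}(A)$ $$r(J)=\{a\in A:\varphi(a)B+B\varphi(a)\subseteq J\}\in\mathbb{I}(A),\qquad i(I)=\overline{\mathrm{span}}\,B\varphi(I)B\in\mathbb{I}(B).$$ Ideals of the form $r(J)$ are called restricted and $\mathbb{I}^B(A)=r(\mathbb{I}(B))$; ideals of the form $i(I)$ are called induced. An ideal $I\in\mathbb{I}(A)$ is symmetric for $\varphi$ if $\varphi(I)B=B\varphi(I)$. The $*$-homomorphism $\varphi$ is symmetric if every restricted ideal of $A$ is symmetric. An inclusion $A\subseteq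 B$ of a C*-subalgebra is regarded as the $*$-homomorphism $A\hookrightarrow B\subseteq\mathcal{M}(B)$ and is called symmetric if this $*$-homomorphism is. *)

(* Defs.v *)
From HB Require Import structures.
From mathcomp Require Import all_boot all_order all_algebra.
From mathcomp Require Import all_classical all_reals all_analysis.
From mathcomp Require Import complex.

Set Implicit Arguments.
Unset Strict Implicit.
Unset Printing Implicit Defensive.

Import Order.TTheory GRing.Theory Num.Theory numFieldNormedType.Exports.
Local Open Scope classical_set_scope.
Local Open Scope complex_scope.
Local Open Scope ring_scope.

Declare Scope starAlg_scope.
Delimit Scope starAlg_scope with sA.
Reserved Notation "x ** y" (at level 40, left associativity).

(* Algebras need not have a unit, which rules out the ring structures of
   MathComp; hence the separate multiplication. *)
HB.mixin Record isStarAlgebra (R : realType) A of GRing.Lmodule R[i] A := {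
  smul : A -> A -> A;
  star : A -> A;
  smulA : associative smul;
  smul_linearl : forall y (k : R[i]) x x',
    smul (k *: x + x') y = k *: smul x y + smul x' y;
  smul_linearr : forall x (k : R[i]) y y',
    smul x (k *: y + y') = k *: smul x y + smul x y';
  starK : involutive star;
  starM : forall x y, star (smul x y) = smul (star y) (star x);
  star_conjlinear : forall (k : R[i]) x y,
    star (k *: x + y) = k^* *: star x + star y
}.

#[short(type="starAlgType")]
HB.structure Definition StarAlgebra (R : realType) :=
  {A of isStarAlgebra R A & GRing.Lmodule R[i] A}.

Notation "x ** y" := (smul x y) : starAlg_scope.
Local Open Scope starAlg_scope.

(* The norm of a normed module over R[i] is R[i]-valued, with values in the
   nonnegative reals. *)
HB.mixin Record isCStarAlgebra (R : realType) A
    of StarAlgebra R A & CompleteNormedModule R[i] A := {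
  normM_le : forall x y : A, `|x ** y| <= `|x| * `|y|;
  cstar_identity : forall x : A, `|star x ** x| = `|x| ^+ 2
}.

#[short(type="cStarAlgType")]
HB.structure Definition CStarAlgebra (R : realType) :=
  {A of isCStarAlgebra R A & StarAlgebra R A & CompleteNormedModule R[i] A}.

Section star_algebra_theory.
Context {R : realType} {A : starAlgType R}.
Implicit Types (x y z : A) (k : R[i]).

Lemma smulDl x y z : (x + y) ** z = x ** z + y ** z.
Proof. by rewrite -[x]scale1r smul_linearl !scale1r. Qed.

Lemma smulDr x y z : x ** (y + z) = x ** y + x ** z.
Proof. by rewrite -[y]scale1r smul_linearr !scale1r. Qed.

Lemma smul0l x : 0 ** x = 0.
Proof. by apply: (addrI (0 ** x)); rewrite -smulDl !addr0. Qed.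

Lemma smul0r x : x ** 0 = 0.
Proof. by apply: (addrI (x ** 0)); rewrite -smulDr !addr0. Qed.

Lemma smulZl k x y : (k *: x) ** y = k *: (x ** y).
Proof. by rewrite -[k *: x]addr0 smul_linearl smul0l addr0. Qed.

Lemma smulZr k x y : x ** (k *: y) = k *: (x ** y).
Proof. by rewrite -[k *: y]addr0 smul_linearr smul0r addr0. Qed.

Lemma starD x y : star (x + y) = star x + star y.
Proof. by rewrite -[x]scale1r star_conjlinear conjC1 !scale1r. Qed.

Lemma star0 : star (0 : A) = 0.
Proof. by apply: (addrI (star 0)); rewrite -starD !addr0. Qed.

Lemma starZ k x : star (k *: x) = k^* *: star x.
Proof. by rewrite -[k *: x]addr0 star_conjlinear star0 addr0. Qed.

Lemma starB x y : star (x - y) = star x - star y.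
Proof.
by rewrite addrC -scaleN1r star_conjlinear rmorphN1 scaleN1r addrC.
Qed.

Lemma smulBl x y z : (x - y) ** z = x ** z - y ** z.
Proof. by rewrite smulDl -scaleN1r smulZl scaleN1r. Qed.

Lemma smulBr x y z : x ** (y - z) = x ** y - x ** z.
Proof. by rewrite smulDr -[- z]scaleN1r smulZr scaleN1r. Qed.

End star_algebra_theory.

Section cstar_algebra_theory.
Context {R : realType} {A : cStarAlgType R}.
Implicit Types x y : A.

Lemma norm_star_le x : `|x| <= `|star x|.
Proof.
have [->|x0] := eqVneq x 0; first by rewrite star0.
have nx : 0 < `|x| by rewrite normr_gt0.
by rewrite -(ler_pM2r nx) -expr2 -cstar_identity normM_le.
Qed.

Lemma norm_star x : `|star x| = `|x|.
Proof.
by apply/eqP; rewrite eq_le norm_star_le -{2}[x]starK norm_star_le.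
Qed.

Lemma lipschitz_continuous (f : A -> A) (k : R[i]) : 0 < k ->
  (forall x y, `|f x - f y| <= k * `|x - y|) -> continuous f.
Proof.
move=> k0 fk x; apply/cvgrPdist_lt => e e0; near=> y.
apply: le_lt_trans (fk _ _) _.
rewrite mulrC -ltr_pdivlMr//; near: y.
by apply: cvgr_dist_lt => //; rewrite divr_gt0.
Unshelve. all: by end_near. Qed.

Lemma star_continuous : continuous (@star R A).
Proof.
by apply: (@lipschitz_continuous _ 1) => // x y; rewrite mul1r -starB norm_star.
Qed.

Lemma smull_continuous x : continuous (smul x).
Proof.
apply: (@lipschitz_continuous _ (`|x| + 1)); first by rewrite ltr_wpDl.
move=> y z; rewrite -smulBr; apply: le_trans (normM_le _ _) _.
by rewrite ler_wpM2r// lerDl.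
Qed.

Lemma smulr_continuous x : continuous (smul^~ x).
Proof.
apply: (@lipschitz_continuous _ (`|x| + 1)); first by rewrite ltr_wpDl.
move=> y z; rewrite -smulBl; apply: le_trans (normM_le _ _) _.
by rewrite mulrC ler_wpM2r// lerDl.
Qed.

End cstar_algebra_theory.

Section star_homomorphisms.
Context {R : realType}.

Record starHom (A B : starAlgType R) := StarHom {
  starHom_fun :> A -> B;
  starHom_linear : forall (k : R[i]) x y,
    starHom_fun (k *: x + y) = k *: starHom_fun x + starHom_fun y;
  starHomM : {morph starHom_fun : x y / x ** y};
  starHom_star : {morph starHom_fun : x / star x}
}.

Program Definition starHom_comp (A B C : starAlgType R)
    (g : starHom B C) (f : starHom A B) : starHom A C :=
  @StarHom A C (g \o f) _ _ _.
Next Obligation. by move=> A B C g f k x y /=; rewrite !starHom_linear. Qed.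
Next Obligation. by move=> A B C g f x y /=; rewrite !starHomM. Qed.
Next Obligation. by move=> A B C g f x /=; rewrite !starHom_star. Qed.

End star_homomorphisms.

(** The multiplier algebra, as the algebra of double centralizers:
    for m in M(B), [lact m b] is m b and [ract m b] is b m.  Only its
    *-algebra structure is built, which is all that the notion of a
    *-homomorphism into M(B) involves. *)
Section multiplier_algebra.
Context {R : realType}.

Record multiplier (B : cStarAlgType R) := Multiplier {
  lact : B -> B;
  ract : B -> B;
  lact_linear : linear lact;
  ract_linear : linear ract;
  lact_continuous : continuous lact;
  ract_continuous : continuous ract;
  lactM : forall b c, lact (b ** c) = lact b ** c;
  ractM : forall b c, ract (b ** c) = b ** ract c;
  lractM : forall b c, b ** lact c = ract b ** c
}.

Variable B : cStarAlgType R.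
Local Notation M := (multiplier B).
Implicit Types m n p : M.

Lemma multiplierP m n : lact m =1 lact n -> ract m =1 ract n -> m = n.
Proof.
case: m n => [l r l1 r1 l2 r2 l3 r3 lr] [l' r' l1' r1' l2' r2' l3' r3' lr'] /=.
move=> /funext ll' /funext rr'.
by case: _ / ll' in l1' l2' l3' lr' *; case: _ / rr' in r1' r2' r3' lr' *;
  congr Multiplier; exact: Prop_irrelevance.
Qed.

HB.instance Definition _ := gen_eqMixin M.
HB.instance Definition _ := gen_choiceMixin M.

Let lactD m : {morph lact m : b c / b + c}.
Proof. by move=> b c; have := lact_linear m 1 b c; rewrite !scale1r. Qed.
Let ractD m : {morph ract m : b c / b + c}.
Proof. by move=> b c; have := ract_linear m 1 b c; rewrite !scale1r. Qed.
Let lact0 m : lact m 0 = 0.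
Proof. by apply: (addrI (lact m 0)); rewrite -lactD !addr0. Qed.
Let ract0 m : ract m 0 = 0.
Proof. by apply: (addrI (ract m 0)); rewrite -ractD !addr0. Qed.
Let lactZ m k b : lact m (k *: b) = k *: lact m b.
Proof. by rewrite -[k *: b]addr0 lact_linear lact0 addr0. Qed.
Let ractZ m k b : ract m (k *: b) = k *: ract m b.
Proof. by rewrite -[k *: b]addr0 ract_linear ract0 addr0. Qed.

Program Definition mult_zero : M :=
  @Multiplier B (fun=> 0) (fun=> 0) _ _ _ _ _ _ _.
Next Obligation. by move=> k b c; rewrite scaler0 addr0. Qed.
Next Obligation. by move=> k b c; rewrite scaler0 addr0. Qed.
Next Obligation. by move=> b; exact: cvg_cst. Qed.
Next Obligation. by move=> b; exact: cvg_cst. Qed.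
Next Obligation. by move=> b c /=; rewrite smul0l. Qed.
Next Obligation. by move=> b c /=; rewrite smul0r. Qed.
Next Obligation. by move=> b c /=; rewrite smul0l smul0r. Qed.

Program Definition mult_add m n : M := @Multiplier B
  (fun b => lact m b + lact n b) (fun b => ract m b + ract n b) _ _ _ _ _ _ _.
Next Obligation.
by move=> m n k b c; rewrite !lact_linear scalerDr addrACA.
Qed.
Next Obligation.
by move=> m n k b c; rewrite !ract_linear scalerDr addrACA.
Qed.
Next Obligation. by move=> m n b; apply: cvgD; exact: lact_continuous. Qed.
Next Obligation. by move=> m n b; apply: cvgD; exact: ract_continuous. Qed.
Next Obligation. by move=> m n b c /=; rewrite !lactM smulDl. Qed.
Next Obligation. by move=> m n b c /=; rewrite !ractM smulDr. Qed.
Next Obligation. by move=> m n b c /=; rewrite smulDl smulDr !lractM. Qed.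

Program Definition mult_scale (k : R[i]) m : M := @Multiplier B
  (fun b => k *: lact m b) (fun b => k *: ract m b) _ _ _ _ _ _ _.
Next Obligation.
by move=> k m l b c; rewrite lact_linear scalerDr !scalerA mulrC.
Qed.
Next Obligation.
by move=> k m l b c; rewrite ract_linear scalerDr !scalerA mulrC.
Qed.
Next Obligation. by move=> k m b; apply: cvgZr; exact: lact_continuous. Qed.
Next Obligation. by move=> k m b; apply: cvgZr; exact: ract_continuous. Qed.
Next Obligation. by move=> k m b c /=; rewrite lactM smulZl. Qed.
Next Obligation. by move=> k m b c /=; rewrite ractM smulZr. Qed.
Next Obligation. by move=> k m b c /=; rewrite smulZl smulZr lractM. Qed.

Program Definition mult_mul m n : M := @Multiplier B
  (fun b => lact m (lact n b)) (fun b => ract n (ract m b)) _ _ _ _ _ _ _.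
Next Obligation. by move=> m n k b c; rewrite !lact_linear. Qed.
Next Obligation. by move=> m n k b c; rewrite !ract_linear. Qed.
Next Obligation.
move=> m n b; apply: (@continuous_comp _ _ _ (lact n) (lact m));
  exact: lact_continuous.
Qed.
Next Obligation.
move=> m n b; apply: (@continuous_comp _ _ _ (ract m) (ract n));
  exact: ract_continuous.
Qed.
Next Obligation. by move=> m n b c /=; rewrite !lactM. Qed.
Next Obligation. by move=> m n b c /=; rewrite !ractM. Qed.
Next Obligation. by move=> m n b c /=; rewrite !lractM. Qed.

Program Definition mult_star m : M := @Multiplier B
  (fun b => star (ract m (star b))) (fun b => star (lact m (star b)))
  _ _ _ _ _ _ _.
Next Obligation.
by move=> m k b c; rewrite star_conjlinear ract_linear star_conjlinear conjCK.
Qed.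
Next Obligation.
by move=> m k b c; rewrite star_conjlinear lact_linear star_conjlinear conjCK.
Qed.
Next Obligation.
move=> m b; apply: (@continuous_comp _ _ _ (ract m \o star) star).
  apply: continuous_comp; [exact: star_continuous|exact: ract_continuous].
exact: star_continuous.
Qed.
Next Obligation.
move=> m b; apply: (@continuous_comp _ _ _ (lact m \o star) star).
  apply: continuous_comp; [exact: star_continuous|exact: lact_continuous].
exact: star_continuous.
Qed.
Next Obligation. by move=> m b c /=; rewrite starM ractM starM starK. Qed.
Next Obligation. by move=> m b c /=; rewrite starM lactM starM starK. Qed.
Next Obligation.
by move=> m b c /=; rewrite -{1}[b]starK -starM -lractM starM starK.
Qed.

Let mult_addA : associative mult_add.
Proof. by move=> m n p; apply: multiplierP => b /=; rewrite addrA. Qed.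
Let mult_addC : commutative mult_add.
Proof. by move=> m n; apply: multiplierP => b /=; rewrite addrC. Qed.
Let mult_add0 : left_id mult_zero mult_add.
Proof. by move=> m; apply: multiplierP => b /=; rewrite add0r. Qed.
Let mult_addN : left_inverse mult_zero (mult_scale (-1)) mult_add.
Proof. by move=> m; apply: multiplierP => b /=; rewrite scaleN1r addNr. Qed.

HB.instance Definition _ :=
  GRing.isZmodule.Build M mult_addA mult_addC mult_add0 mult_addN.

Let mult_scaleA k l m : mult_scale k (mult_scale l m) = mult_scale (k * l) m.
Proof. by apply: multiplierP => b /=; rewrite scalerA. Qed.
Let mult_scale1 : left_id 1 mult_scale.
Proof. by move=> m; apply: multiplierP => b /=; rewrite scale1r. Qed.
Let mult_scaleDr : right_distributive mult_scale +%R.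
Proof. by move=> k m n; apply: multiplierP => b /=; rewrite scalerDr. Qed.
Let mult_scaleDl m : {morph mult_scale^~ m : k l / k + l}.
Proof. by move=> k l; apply: multiplierP => b /=; rewrite scalerDl. Qed.

HB.instance Definition _ := GRing.Zmodule_isLmodule.Build R[i] M
  mult_scaleA mult_scale1 mult_scaleDr mult_scaleDl.

Let mult_mulA : associative mult_mul.
Proof. by move=> m n p; apply: multiplierP. Qed.
Let mult_linearl n k m m' :
  mult_mul (k *: m + m') n = k *: mult_mul m n + mult_mul m' n.
Proof. by apply: multiplierP => b //=; rewrite ract_linear. Qed.
Let mult_linearr m k n n' :
  mult_mul m (k *: n + n') = k *: mult_mul m n + mult_mul m n'.
Proof. by apply: multiplierP => b //=; rewrite lact_linear. Qed.
Let mult_starK : involutive mult_star.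
Proof. by move=> m; apply: multiplierP => b /=; rewrite !starK. Qed.
Let mult_starM m n :
  mult_star (mult_mul m n) = mult_mul (mult_star n) (mult_star m).
Proof. by apply: multiplierP => b /=; rewrite !starK. Qed.
Let mult_star_conjlinear k m n :
  mult_star (k *: m + n) = k^* *: mult_star m + mult_star n.
Proof. by apply: multiplierP => b /=; rewrite star_conjlinear. Qed.

HB.instance Definition _ := isStarAlgebra.Build R M
  mult_mulA mult_linearl mult_linearr mult_starK mult_starM
  mult_star_conjlinear.

Program Definition mult_of (b : B) : M :=
  @Multiplier B (smul b) (smul^~ b) _ _ _ _ _ _ _.
Next Obligation. by move=> b k c d; rewrite smul_linearr. Qed.
Next Obligation. by move=> b k c d; rewrite smul_linearl. Qed.
Next Obligation. by move=> b; exact: smull_continuous. Qed.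
Next Obligation. by move=> b; exact: smulr_continuous. Qed.
Next Obligation. by move=> b c d /=; rewrite smulA. Qed.
Next Obligation. by move=> b c d /=; rewrite smulA. Qed.
Next Obligation. by move=> b c d /=; rewrite smulA. Qed.

Program Definition mult_embedding : starHom B M := @StarHom R B M mult_of _ _ _.
Next Obligation.
by move=> k b c; apply: multiplierP => d /=; rewrite ?smul_linearl ?smul_linearr.
Qed.
Next Obligation. by move=> b c; apply: multiplierP => d /=; rewrite smulA. Qed.
Next Obligation.
by move=> b; apply: multiplierP => d /=; rewrite starM starK.
Qed.

Lemma smul_mult_embedding m b :
  m ** mult_embedding b = mult_embedding (lact m b).
Proof. by apply: multiplierP => c /=; rewrite ?lactM ?lractM. Qed.

Lemma mult_embedding_smul m b :
  mult_embedding b ** m = mult_embedding (ract m b).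
Proof. by apply: multiplierP => c /=; rewrite ?ractM ?lractM. Qed.

End multiplier_algebra.

Section cstar_subalgebras.
Context {R : realType}.

Record cStarSubalg (B : cStarAlgType R) := CStarSubalg {
  subalg_set :> set B;
  subalg_closed : closed subalg_set;
  subalg0 : subalg_set 0;
  subalg_linear : forall (k : R[i]) x y,
    subalg_set x -> subalg_set y -> subalg_set (k *: x + y);
  subalgM : forall x y, subalg_set x -> subalg_set y -> subalg_set (x ** y);
  subalg_star : forall x, subalg_set x -> subalg_set (star x)
}.

Variables (B : cStarAlgType R) (S : cStarSubalg B).

(* S as a C*-algebra in its own right, with the operations and norm of B *)
Record subalg : Type := Subalg {
  subalg_val : B;
  subalg_valP : subalg_val \in (S : set B)
}.

HB.instance Definition _ := [isSub for subalg_val].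
HB.instance Definition _ := [Choice of subalg by <:].

Let subalg_submod : submod_closed [pred x : B | x \in (S : set B)].
Proof.
split=> [|k x y]; rewrite !inE; [exact: subalg0|exact: subalg_linear].
Qed.

HB.instance Definition _ :=
  GRing.SubChoice_isSubLmodule.Build R[i] B _ subalg subalg_submod.

Let sub_norm (x : subalg) : R[i] := `|val x|.
Let sub_normD x y : sub_norm (x + y) <= sub_norm x + sub_norm y.
Proof. exact: ler_normD. Qed.
Let sub_normZ k x : sub_norm (k *: x) = `|k| * sub_norm x.
Proof. exact: normrZ. Qed.
Let sub_norm0 x : sub_norm x = 0 -> x = 0.
Proof. by move=> /normr0_eq0 x0; exact: val_inj. Qed.

HB.instance Definition _ :=
  Lmodule_isNormed.Build R[i] subalg sub_normD sub_normZ sub_norm0.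

Lemma subalg_cauchy_cvg (F : set_system subalg) :
  ProperFilter F -> cauchy F -> cvg F.
Proof.
move=> FF cF; pose G : set_system B := (val : subalg -> B) @ F.
have valB (x y : subalg) : val (x - y) = val x - val y by exact: raddfB.
have cG : cauchy G.
  apply/cauchyP => e e0; have /cauchyP/(_ e e0)[x Fx] := cF.
  exists (val x); rewrite /G /nbhs/=; apply: filterS Fx => y.
  by rewrite -!ball_normE /ball_/= -valB.
have /cvg_ex[l Gl] : cvg G by exact: cauchy_cvg.
have Sl : (S : set B) l.
  apply: (closed_cvg (S : set B) (@subalg_closed _ S) _ _ Gl).
  by apply: nearW => x; have := subalg_valP x; rewrite inE.
apply/cvg_ex; exists (Subalg (mem_set Sl)).
apply/cvgrPdist_lt => e e0.
have /cvgrPdist_lt/(_ e e0) := Gl.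
by apply: filterS => x; rewrite -[l]/(val (Subalg (mem_set Sl))) -valB.
Qed.

HB.instance Definition _ := Uniform_isComplete.Build subalg subalg_cauchy_cvg.

Let in_subalg (x : B) : (S : set B) x -> x \in (S : set B).
Proof. by rewrite inE. Qed.
Let subalg_valS (x : subalg) : (S : set B) (val x).
Proof. by have := subalg_valP x; rewrite inE. Qed.

Definition subalg_mul (x y : subalg) : subalg :=
  Subalg (in_subalg (subalgM (subalg_valS x) (subalg_valS y))).
Definition subalg_inv (x : subalg) : subalg :=
  Subalg (in_subalg (subalg_star (subalg_valS x))).

Let subalg_mulA : associative subalg_mul.
Proof. by move=> x y z; apply: val_inj; rewrite /= smulA. Qed.
Let valDZ (k : R[i]) (x y : subalg) : val (k *: x + y) = k *: val x + val y.
Proof. exact: (linearP (val : subalg -> B)). Qed.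
Let subalg_linearl y (k : R[i]) x x' :
  subalg_mul (k *: x + x') y = k *: subalg_mul x y + subalg_mul x' y.
Proof. by apply: val_inj; rewrite valDZ /= -smul_linearl -valDZ. Qed.
Let subalg_linearr x (k : R[i]) y y' :
  subalg_mul x (k *: y + y') = k *: subalg_mul x y + subalg_mul x y'.
Proof. by apply: val_inj; rewrite valDZ /= -smul_linearr -valDZ. Qed.
Let subalg_invK : involutive subalg_inv.
Proof. by move=> x; apply: val_inj; rewrite /= starK. Qed.
Let subalg_invM x y :
  subalg_inv (subalg_mul x y) = subalg_mul (subalg_inv y) (subalg_inv x).
Proof. by apply: val_inj; rewrite /= starM. Qed.
Let subalg_inv_conjlinear (k : R[i]) x y :
  subalg_inv (k *: x + y) = k^* *: subalg_inv x + subalg_inv y.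
Proof. by apply: val_inj; rewrite valDZ /= -star_conjlinear -valDZ. Qed.

HB.instance Definition _ := isStarAlgebra.Build R subalg
  subalg_mulA subalg_linearl subalg_linearr subalg_invK subalg_invM
  subalg_inv_conjlinear.

Let subalg_normM_le (x y : subalg) : `|x ** y| <= `|x| * `|y|.
Proof. exact: (normM_le (val x) (val y)). Qed.
Let subalg_cstar_identity (x : subalg) : `|star x ** x| = `|x| ^+ 2.
Proof. exact: (cstar_identity (val x)). Qed.

HB.instance Definition _ :=
  isCStarAlgebra.Build R subalg subalg_normM_le subalg_cstar_identity.

Definition subalg_incl : starHom subalg B :=
  @StarHom R subalg B (val : subalg -> B) valDZ
    (fun _ _ => erefl) (fun _ => erefl).

Definition inclusion : starHom subalg (multiplier B) :=
  starHom_comp (mult_embedding B) subalg_incl.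

End cstar_subalgebras.

Section ideals.
Context {R : realType}.

Section lattice.
Variable A : cStarAlgType R.
Implicit Types (X I : set A) (F : set (set A)).

Definition lspan X : set A :=
  [set x | exists n (k : 'I_n -> R[i]) (y : 'I_n -> A),
     (forall i, X (y i)) /\ x = \sum_(i < n) k i *: y i].

Definition closed_span X : set A := closure (lspan X).

Definition ideal : set (set A) := [set I |
  [/\ closed I,
      I 0,
      forall (k : R[i]) x y, I x -> I y -> I (k *: x + y)
    & forall a x, I x -> I (a ** x) /\ I (x ** a)]].

Definition ideal_join F : set A := closed_span (\bigcup_(I in F) I).

Lemma sub_closed_span X : X `<=` closed_span X.
Proof.
move=> x Xx; apply: subset_closure.
by exists 1%N, (fun=> 1), (fun=> x); rewrite big_ord1 scale1r.
Qed.

Lemma closed_span0 X : closed_span X 0.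
Proof.
apply: subset_closure; exists 0%N, (fun=> 0), (fun=> 0).
by rewrite big_ord0; split => // -[].
Qed.

Lemma closed_span_linear X (k : R[i]) x y :
  closed_span X x -> closed_span X y -> closed_span X (k *: x + y).
Proof.
have lin (u v : A) : lspan X u -> lspan X v -> lspan X (k *: u + v).
  move=> [n [c [z [Xz ->]]]] [m [d [w [Xw ->]]]].
  exists (n + m)%N.
  exists (fun i : 'I_(n + m) => match fintype.split i with inl j => k * c j | inr j => d j end).
  exists (fun i : 'I_(n + m) => match fintype.split i with inl j => z j | inr j => w j end).
  split; first by move=> i; case: (fintype.split i).
  rewrite big_split_ord/= scaler_sumr; congr (_ + _); apply: eq_bigr => i _.
    by rewrite (unsplitK (inl i)) scalerA.
  by rewrite (unsplitK (inr i)).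
move=> cx cy U Uxy.
have : (fun z : A * A => k *: z.1 + z.2) @ (x, y) --> k *: x + y.
  by apply: cvgD; [apply: cvgZr; exact: cvg_fst|exact: cvg_snd].
move=> /(_ U Uxy)[[P Q] /= [Px Qy] PQ].
have [u [Xu Pu]] := cx _ Px; have [v [Xv Qv]] := cy _ Qy.
by exists (k *: u + v); split; [exact: lin|exact: (PQ (u, v))].
Qed.

Lemma closed_span_min X I : X `<=` I -> closed I -> I 0 ->
  (forall (k : R[i]) x y, I x -> I y -> I (k *: x + y)) ->
  closed_span X `<=` I.
Proof.
move=> XI cI I0 Il; rewrite (closure_id I).1//; apply: closure_subset.
move=> x [n [k [y [Xy ->]]]].
have : forall i, I (y i) by move=> i; exact: XI.
elim: n => [|n IH] in k y Xy *; first by rewrite big_ord0.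
by move=> Iy; rewrite big_ord_recl; apply: Il => //; apply: IH.
Qed.

Lemma closed_span_stable X (f : A -> A) : continuous f ->
  (forall (k : R[i]) x y, f (k *: x + y) = k *: f x + f y) ->
  (forall x, X x -> closed_span X (f x)) ->
  forall x, closed_span X x -> closed_span X (f x).
Proof.
move=> cf lf Xf; apply: closed_span_min => //.
- apply: (closed_comp (D := closed_span X)); last exact: closed_closure.
  by move=> x _; exact: cf.
- have f0 : f 0 = 0 by apply: (addrI (f 0)); rewrite -{1}[f 0]scale1r -lf scaler0 !addr0.
  by rewrite f0; exact: closed_span0.
- by move=> k x y Xx Xy; rewrite lf; exact: closed_span_linear.
Qed.

Lemma ideal_closed_span X :
  (forall a x, X x -> X (a ** x) /\ X (x ** a)) -> ideal (closed_span X).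
Proof.
move=> Xa; split; first exact: closed_closure.
- exact: closed_span0.
- exact: closed_span_linear.
- move=> a x Xx; split.
    apply: (closed_span_stable (f := smul a)) Xx => //.
    + exact: smull_continuous.
    + exact: smul_linearr.
    + by move=> y /(Xa a)[? _]; exact: sub_closed_span.
  apply: (closed_span_stable (f := smul^~ a)) Xx => //.
  + exact: smulr_continuous.
  + by move=> *; exact: smul_linearl.
  + by move=> y /(Xa a)[_ ?]; exact: sub_closed_span.
Qed.

Lemma ideal_bigcap F : F `<=` ideal -> ideal (\bigcap_(I in F) I).
Proof.
move=> Fi; split.
- by apply: closed_bigI => I /Fi[].
- by move=> I /Fi[].
- by move=> k x y Fx Fy I FI; have [_ _ + _] := Fi _ FI; apply; [exact: Fx|exact: Fy].
- by move=> a x Fx; split=> I FI; have [_ _ _ /(_ a x (Fx _ FI))[]] := Fi _ FI.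
Qed.

Lemma ideal_joinP F : F `<=` ideal ->
  [/\ ideal (ideal_join F),
      forall I, F I -> I `<=` ideal_join F
    & forall J, ideal J -> (forall I, F I -> I `<=` J) -> ideal_join F `<=` J].
Proof.
move=> Fi; split.
- apply: ideal_closed_span => a x [I FI Ix].
  by have [_ _ _ /(_ a x Ix)[? ?]] := Fi _ FI; split; exists I.
- by move=> I FI x Ix; apply: sub_closed_span; exists I.
- by move=> J [cJ J0 Jl _] FJ; apply: closed_span_min => // x [I /FJ]; exact.
Qed.

End lattice.

Variables (A B : cStarAlgType R) (phi : starHom A (multiplier B)).

(* [a] such that phi(a)B + B phi(a) is contained in [J] *)
Definition restriction (J : set B) : set A := [set a |
  [set lact (phi a) b + ract (phi a) c | b in setT & c in setT] `<=` J].

Definition induction (I : set A) : set B := closed_span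
  [set x | exists b a c, I a /\ x = b ** lact (phi a) c].

Definition restricted : set (set A) := [set restriction J | J in @ideal B].
Definition induced : set (set B) := [set induction I | I in @ideal A].

(* phi(I)B = B phi(I), where products of subspaces are closed linear spans *)
Definition symmetric_ideal (I : set A) : Prop :=
  closed_span [set lact (phi a) b | a in I & b in setT] =
  closed_span [set ract (phi a) b | a in I & b in setT].

Definition symmetric_hom : Prop :=
  forall I, restricted I -> symmetric_ideal I.

Lemma ideal_induction I : ideal I -> ideal (induction I).
Proof.
move=> _; apply: ideal_closed_span => d _ [b [a [c [Ia ->]]]]; split.
  by exists (d ** b), a, c; rewrite smulA.
by exists b, a, (c ** d); rewrite lactM smulA.
Qed.

Definition cond_JR : Prop := forall F : set (set A),
  F `<=` restricted -> restricted (ideal_join F).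

Definition cond_FR1 : Prop := forall I J, restricted I -> ideal J ->
  restriction (induction (I `&` J)) = I `&` restriction (induction J).

Definition cond_MIf : Prop := forall F : set (set B),
  finite_set F -> F !=set0 -> F `<=` induced -> induced (\bigcap_(K in F) K).

End ideals.

Definition symmetric_inclusion {R : realType} (B : cStarAlgType R)
    (S : cStarSubalg B) : Prop := symmetric_hom (inclusion S).

(* Main.v *)
Require Import Defs.
From mathcomp Require Import all_boot all_order all_algebra.
From mathcomp Require Import all_classical all_reals all_analysis.
From mathcomp Require Import complex.

Set Implicit Arguments.
Unset Strict Implicit.
Unset Printing Implicit Defensive.

Import Order.TTheory GRing.Theory Num.Theory numFieldNormedType.Exports.
Local Open Scope classical_set_scope.
Local Open Scope complex_scope.
Local Open Scope ring_scope.
Local Open Scope starAlg_scope.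

(** The Galois connection between restriction r and induction i gives
    r o i o r = r and i o r o i = i; in particular every induced ideal is
    induced by a restricted one.  Conditions (FR1) and (MI_f) both follow from
    one inclusion: if I is a symmetric ideal of A and I' is any ideal, then
    i(I) `&` i(I') is contained in i(I `&` I') ([capI_sub_induction]).  Indeed
    i(I) `&` i(I') is the closed span of i(I) i(I'), and in a product
    b phi(a) c b' phi(a') c' the symmetry of I moves the factor phi(a) past
    c b', leaving a sum of terms d phi(a'' a') c' with a'' a' in I `&` I'.
    For (MI_f) the restricted ideals also have to be closed, that is, phi has
    to be continuous in the strict topology ([lact_starHom_continuous]).

    For an inclusion and a join I of restricted ideals, symmetry of the
    members of the family shows that i(I) lies in the closed span of I B.  An
    element a of A with a B in i(I) is then in the closed span of I B, so that
    an approximate unit of I, acting on the left, fixes a in the limit, and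
    a is in I ([subalg_mem_closed_span]).  Hence r(i(I)) = I.

    The C*-algebraic input is thus: contractive approximate units, and
    continuity of *-homomorphisms.  Both are derived from the C*-identity
    without spectral theory.  The basic remark is that maps u, v : B -> B with
    adjoints u', v' have |u x| = |v x| as soon as u' u = v' v
    ([norm_eq_adjoint]).

    - For f self-adjoint, 1 + i f and 1 - i f have the same norm at x, and
      their sum is 2; so |x| <= |x + i f x|, and, applying this to f and - f,
      |x| <= |x + f^2 x|.  Writing g = f^2, one gets
      |(1 - g) x| <= |(1 + g)(1 - g) x| = |(1 - g^2) x|, and repeated squaring
      of a small g yields |(1 - f^2) x| <= |x| ([norm_sub_sq_le]).
    - For k self-adjoint and small, the Cesaro mean T of the contractions
      (1 - k^2)^j, j <= n, is a contraction with T k^2 of norm O(1/n), by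
      telescoping.  Also T = 1 - e with e a polynomial in k without constant
      term, and e is the approximate unit ([approximate_unit]).
    - For k self-adjoint and small in A, a fixed-point iteration gives s in A
      with k^2 + (1 - s)^2 = 1.  This identity is transported by phi, and makes
      phi(k) + i (1 - phi(s)) and its adjoint isometric on B; hence phi(k) is
      contractive ([norm_lact_starHom_le]). *)

(** * Limits in complex normed spaces *)

Lemma complex_archimedean (R : realType) (e : R[i]) :
  0 < e -> exists n, n.+1%:R^-1 < e.
Proof.
case: e => a b; rewrite ltcE /= => /andP[/eqP -> /ltr_add_invr[n]].
rewrite add0r => na; exists n.
by rewrite -(rmorph_nat (real_complex R)) -fmorphV ltcE /= eqxx.
Qed.

Section approximation.
Context {R : realType} {V : normedModType R[i]}.
Implicit Types (C : set V) (x : V).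

Lemma closure_approx C x :
  closure C x -> forall e, 0 < e -> exists2 y, C y & `|x - y| <= e.
Proof.
move=> Cx e e0; have [y [Cy]] := Cx _ (nbhsx_ballx x e e0).
by rewrite -ball_normE => xy; exists y => //; exact: ltW.
Qed.

Lemma closed_approx C x : closed C ->
  (forall e, 0 < e -> exists2 y, C y & `|x - y| <= e) -> C x.
Proof.
move=> cC Cx; rewrite (closure_id C).1// => U.
rewrite -nbhs_ballE => -[e /= e0 eU].
have [y Cy xy] := Cx (e / 2) (divr_gt0 e0 (ltr0n _ 2)).
exists y; split => //; apply: eU; rewrite -ball_normE /ball_/=.
by apply: le_lt_trans xy _; rewrite gtr_pMr// invf_lt1// ltr1n.
Qed.

Lemma closed_of_approx C :
  (forall x, (forall e, 0 < e -> exists2 y, C y & `|x - y| <= e) -> C x) ->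
  closed C.
Proof. by move=> CC x /closure_approx; exact: CC. Qed.

End approximation.

(** * Maps with an adjoint on a C*-algebra *)

Section opposites.
Context {R : realType} {A : starAlgType R}.
Implicit Types x y : A.

Lemma smulNl x y : (- x) ** y = - (x ** y).
Proof. by rewrite -[- x]add0r smulBl smul0l add0r. Qed.

Lemma smulNr x y : x ** (- y) = - (x ** y).
Proof. by rewrite -[- y]add0r smulBr smul0r add0r. Qed.

Lemma starN x : star (- x) = - star x.
Proof. by rewrite -[- x]add0r starB star0 add0r. Qed.

End opposites.

Section adjoint_pairs.
Context {R : realType} {B : cStarAlgType R}.
Implicit Types (x y : B) (f g u v : B -> B).

(** The B-valued inner product is (x, y) |-> x^* y.  The unit of M(B), left
    multiplications and multipliers are then all treated as maps on B. *)
Definition adjoint f g := forall x y, star (f x) ** y = star x ** g y.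

Lemma adjoint_add f f' g g' : adjoint f f' -> adjoint g g' ->
  adjoint (fun x => f x + g x) (fun x => f' x + g' x).
Proof. by move=> ff gg x y; rewrite starD smulDl ff gg smulDr. Qed.

Lemma adjoint_scale k f f' : adjoint f f' ->
  adjoint (fun x => k *: f x) (fun x => k^* *: f' x).
Proof. by move=> ff x y; rewrite starZ smulZl ff smulZr. Qed.

Lemma adjoint_smul x : adjoint (smul x) (smul (star x)).
Proof. by move=> y z; rewrite starM smulA. Qed.

Lemma adjoint_lact (m : multiplier B) : adjoint (lact m) (lact (star m)).
Proof. by move=> x y; rewrite lractM /= starK. Qed.

Lemma norm_sq x : `|x| ^+ 2 = `|star x ** x|.
Proof. by rewrite cstar_identity. Qed.

Lemma norm_sq_le_adjoint u u' x :
  adjoint u u' -> `|u x| ^+ 2 <= `|x| * `|u' (u x)|.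
Proof.
by move=> uu; rewrite norm_sq uu (le_trans (normM_le _ _))// norm_star.
Qed.

(** By the C*-identity |u x|^2 = |x^* u' u x|, which depends on u only through
    u' u. *)
Lemma norm_eq_adjoint u u' v v' x : adjoint u u' -> adjoint v v' ->
  u' (u x) = v' (v x) -> `|u x| = `|v x|.
Proof.
move=> uu vv uv; apply/eqP; rewrite -(@eqrXn2 _ 2)//.
by rewrite !norm_sq uu vv uv.
Qed.

Lemma linear_addr f k x y : linear f -> f (x + k *: y) = f x + k *: f y.
Proof. by move=> lf; rewrite addrC lf addrC. Qed.

(** With u = 1 + i f and its adjoint u' = 1 - i f one has u' u = u u', so both
    have the same norm at x, while u x + u' x = 2 x. *)
Lemma norm_le_add_im f x : adjoint f f -> linear f -> `|x| <= `|x + 'i *: f x|.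
Proof.
move=> ff lf; pose u y := y + 'i *: f y; pose u' y := y + 'i^* *: f y.
have uu : adjoint u u' by apply: adjoint_add => //; exact: adjoint_scale.
have u'u : adjoint u' u.
  have -> : u = fun y => y + ('i^*)^* *: f y.
    by apply/funext => y; rewrite conjCK.
  by apply: adjoint_add => //; exact: adjoint_scale.
have iC : 'i^* = - 'i :> R[i] by exact: conjCi.
have e : `|u x| = `|u' x|.
  apply: (norm_eq_adjoint uu u'u).
  rewrite /u /u' !(linear_addr _ _ _ lf) !scalerDr !scalerA iC.
  by rewrite mulNr mulrN addrACA.
rewrite -(@ler_pM2l _ 2)// -[leRHS]/(2 * `|u x|).
have -> : 2 * `|x| = `|u x + u' x|.
  by rewrite /u /u' iC scaleNr addrACA subrr addr0 -mulr2n normrMn mulr_natl.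
by rewrite (le_trans (ler_normD _ _))// -e mulr_natl mulr2n.
Qed.

(** 1 + f^2 = (1 - i f)(1 + i f); this stands in for the fact that 1 plus a
    positive operator is bounded below by 1. *)
Lemma norm_le_add_sq f x : adjoint f f -> linear f -> `|x| <= `|x + f (f x)|.
Proof.
move=> ff lf; apply: le_trans (norm_le_add_im x ff lf) _.
pose g y := - f y; have lg : linear g.
  by move=> k y z; rewrite /g lf opprD scalerN.
have gg : adjoint g g by move=> y z; rewrite /g starN smulNl ff smulNr.
apply: le_trans (norm_le_add_im _ gg lg) _.
rewrite /g (linear_addr _ _ _ lf) scalerN scalerDr scalerA -expr2 sqrCi.
rewrite scaleN1r opprB addrA [X in `|X|]addrAC addrK.
by rewrite [X in _ <= `|X|]addrC [X in `|X|]addrC.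
Qed.

End adjoint_pairs.

(** * Contractivity of 1 - f^2 *)

Section contractions.
Context {R : realType} {B : cStarAlgType R}.
Implicit Types (x y : B) (f : B -> B).

(** The induction replaces f by g = f^2, using
    |(1 - g) x| <= |(1 + g)(1 - g) x| = |(1 - g^2) x|, so that the
    bound q on the operator is squared at each step. *)
Lemma norm_sub_sq_le_pow f q n : adjoint f f -> linear f ->
  0 <= q <= 1 -> (forall y, `|f y| <= q * `|y|) ->
  forall x, `|x - f (f x)| <= (1 + q ^+ n.+1) * `|x|.
Proof.
elim: n f q => [|n IH] f q ff lf /andP[q0 q1] fq x.
  rewrite (le_trans (ler_normB _ _))// mulrDl mul1r lerD2l.
  rewrite (le_trans (fq _))// expr1 ler_wpM2l//.
  by rewrite (le_trans (fq _))// ler_piMl.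
pose g y := f (f y).
have lg : linear g by move=> k y z; rewrite /g !lf.
have gg : adjoint g g by move=> y z; rewrite /g !ff.
have g1 : g (x - g x) = g x - g (g x).
  by rewrite addrC -scaleN1r lg scaleN1r addrC.
have := norm_le_add_sq (x - g x) ff lf; rewrite -/(g (x - g x)) g1.
rewrite addrA subrK => /le_trans; apply.
have q2 : 0 <= q ^+ 2 <= 1 by rewrite exprn_ge0//= exprn_ile1.
apply: le_trans (IH g (q ^+ 2) gg lg q2 _ x) _.
  by move=> y; rewrite /g (le_trans (fq _))// expr2 -mulrA ler_wpM2l.
rewrite ler_wpM2r// lerD2l -exprM ler_wiXn2l//.
by rewrite mul2n -addnn addSn ltnS leq_addl.
Qed.

Lemma half_pow_le n : 2^-1 ^+ n <= n.+1%:R^-1 :> R[i].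
Proof.
rewrite exprVn lef_pV2 ?posrE ?exprn_gt0 ?ltr0n// -natrX ler_nat.
exact: ltn_expl.
Qed.

Lemma norm_sub_sq_le f : adjoint f f -> linear f ->
  (forall y, `|f y| <= 2^-1 * `|y|) -> forall x, `|x - f (f x)| <= `|x|.
Proof.
move=> ff lf fq x; apply/ler_addgt0Pr => e e0.
have h01 : 0 <= (2^-1 : R[i]) <= 1 by rewrite invr_ge0 ler0n invf_le1// ler1n.
have d0 : 0 < e / (`|x| + 1) by rewrite divr_gt0// ltr_wpDl.
have [n ne] := complex_archimedean d0.
apply: le_trans (norm_sub_sq_le_pow n ff lf h01 fq x) _.
rewrite mulrDl mul1r lerD2l.
have hn : 2^-1 ^+ n.+1 <= e / (`|x| + 1) :> R[i].
  apply: le_trans (half_pow_le _) _; apply: le_trans (ltW ne).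
  by rewrite lef_pV2 ?posrE ?ltr0n// ler_nat.
apply: le_trans (ler_wpM2r (normr_ge0 x) hn) _.
rewrite mulrAC ler_pdivrMr ?ltr_wpDl// ler_wpM2l ?ltW//.
by rewrite ltrDl.
Qed.

End contractions.

(** * Approximate units *)

Section approximate_units.
Context {R : realType} {A : cStarAlgType R}.
Implicit Types (a k x y e : A) (P : set A).

(** In general neither closed nor star-invariant: for an inclusion of
    C*-algebras, P is to be the image of an ideal of the smaller algebra. *)
Definition subalgebra P := [/\ P 0,
  forall (c : R[i]) x y, P x -> P y -> P (c *: x + y)
  & forall x y, P x -> P y -> P (x ** y)].

(** 1 - e is a contraction in the unitization, acting on the left. *)
Definition cocontraction e := forall y, `|y - e ** y| <= `|y|.

Lemma cocontraction0 : cocontraction 0.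
Proof. by move=> y; rewrite smul0l subr0. Qed.

(** The circle product of nonunital ring theory: 1 - circ e e' is
    (1 - e)(1 - e'). *)
Definition circ e e' := e + e' - e ** e'.

Lemma sub_circ e e' y : y - circ e e' ** y = (y - e' ** y) - e ** (y - e' ** y).
Proof.
rewrite /circ smulBl smulDl smulBr smulA !opprD !opprK !addrA; congr (_ + _).
by rewrite addrAC.
Qed.

Lemma cocontraction_circ e e' :
  cocontraction e -> cocontraction e' -> cocontraction (circ e e').
Proof.
by move=> ee ee' y; rewrite sub_circ (le_trans (ee _))// ee'.
Qed.

Lemma subalgebraB P x y : subalgebra P -> P x -> P y -> P (x - y).
Proof.
move=> [_ Pl _] Px Py; rewrite addrC -scaleN1r; exact: Pl.
Qed.

Lemma subalgebraD P x y : subalgebra P -> P x -> P y -> P (x + y).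
Proof. by move=> [_ Pl _] Px Py; rewrite -[x]scale1r; exact: Pl. Qed.

Lemma subalgebraZ P (c : R[i]) x : subalgebra P -> P x -> P (c *: x).
Proof. by move=> [P0 Pl _] Px; rewrite -[_ *: _]addr0; exact: Pl. Qed.

Lemma subalgebra_circ P e e' : subalgebra P -> P e -> P e' -> P (circ e e').
Proof.
move=> sP Pe Pe'; have [_ _ PM] := sP.
by apply: subalgebraB => //; [exact: subalgebraD|exact: PM].
Qed.

(** With T = 1 - e, the C*-identity gives |T a|^2 = |T a a^* T^* |, and T^* is
    contractive.  This reduces the estimate of T a to self-adjoint elements. *)
Lemma cocontraction_sq_le e a :
  cocontraction e -> `|a - e ** a| ^+ 2 <= `|a ** star a - e ** (a ** star a)|.
Proof.
move=> ee; set t := a - e ** a.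
have tT (x : A) : t ** x = a ** x - e ** (a ** x) by rewrite /t smulBl smulA.
rewrite -[`|t|]norm_star norm_sq starK tT.
apply: le_trans (ee _) _; rewrite -norm_star starM starK tT.
by [].
Qed.

Section selfadjoint.
Variable k : A.
Hypotheses (kk : star k = k) (k_le : `|k| <= 2^-1).

Let cocontraction_sq : cocontraction (k ** k).
Proof.
move=> y; rewrite -smulA; apply: (@norm_sub_sq_le R A (smul k)).
- by have := adjoint_smul k; rewrite kk.
- by move=> c x z; rewrite smul_linearr.
- by move=> z; rewrite (le_trans (normM_le _ _))// ler_wpM2r.
Qed.

(** 1 - circ_pow n is (1 - k^2)^n. *)
Definition circ_pow n := iter n (circ^~ (k ** k)) 0.

Definition circ_mean n : A := n.+1%:R^-1 *: \sum_(j < n.+1) circ_pow j.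

Lemma sub_circ_mean n y :
  y - circ_mean n ** y = n.+1%:R^-1 *: \sum_(j < n.+1) (y - circ_pow j ** y).
Proof.
have n0 : n.+1%:R != 0 :> R[i] by rewrite pnatr_eq0.
rewrite sumrB scalerBr sumr_const card_ord -[y *+ _]scaler_nat scalerA mulVf//.
rewrite scale1r.
congr (_ - _); rewrite /circ_mean smulZl; congr (_ *: _).
elim: n.+1 => [|m IH]; first by rewrite !big_ord0 smul0l.
by rewrite !big_ord_recr/= smulDl IH.
Qed.

Lemma cocontraction_circ_pow n : cocontraction (circ_pow n).
Proof.
elim: n => [|n IH]; first exact: cocontraction0.
exact: cocontraction_circ.
Qed.

Lemma cocontraction_circ_mean n : cocontraction (circ_mean n).
Proof.
move=> y; rewrite sub_circ_mean normrZ normfV normr_nat.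
rewrite ler_pdivrMl ?ltr0n//; apply: le_trans (ler_norm_sum _ _ _) _.
rewrite -[n.+1 in leRHS]card_ord mulr_natl -sumr_const ler_sum// => j _.
exact: cocontraction_circ_pow.
Qed.

(** (1 - k^2)^j k^2 y = (1 - k^2)^j y - (1 - k^2)^(j+1) y, so the mean
    telescopes. *)
Lemma circ_mean_sq_le n y :
  `|k ** k ** y - circ_mean n ** (k ** k ** y)| <= n.+1%:R^-1 * (2 * `|y|).
Proof.
have e j : k ** k ** y - circ_pow j ** (k ** k ** y) =
    circ_pow j.+1 ** y - circ_pow j ** y.
  have := sub_circ (circ_pow j) (k ** k) y.
  rewrite -[circ _ _]/(circ_pow j.+1) [_ ** (y - _)]smulBr.
  move=> /(congr1 (fun z => y - z)); rewrite subKr => ->.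
  rewrite opprB [y + _]addrC opprB [_ + (_ - y)]addrA subrK.
  by rewrite [RHS]addrC !addrA addNr add0r addrC.
rewrite sub_circ_mean; under eq_bigr do rewrite e.
rewrite normrZ normfV normr_nat ler_wpM2l ?invr_ge0//.
rewrite -(big_mkord xpredT (fun j => circ_pow j.+1 ** y - circ_pow j ** y)).
rewrite telescope_sumr// smul0l subr0.
rewrite -[X in `|X|](subKr y) mulr_natl mulr2n.
rewrite (le_trans (ler_normB _ _))// lerD2l.
exact: cocontraction_circ_pow.
Qed.

Lemma subalgebra_circ_mean P n : subalgebra P -> P k -> P (circ_mean n).
Proof.
move=> sP Pk; have [P0 Pl PM] := sP; apply: subalgebraZ => //.
have Pp m : P (circ_pow m).
  by elim: m => //= m IH; apply: subalgebra_circ => //; exact: PM.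
by elim/big_ind: _ => // x y; exact: subalgebraD.
Qed.

(** Two applications of [cocontraction_sq_le] lead from k to k^4 = k^2 k^2, to
    which the telescoping estimate applies. *)
Lemma circ_mean_pow4_le n :
  `|k - circ_mean n ** k| ^+ 4 <= n.+1%:R^-1.
Proof.
have ce := cocontraction_circ_mean n.
have := cocontraction_sq_le k ce; rewrite kk => h1.
have := cocontraction_sq_le (k ** k) ce; rewrite starM kk => h2.
rewrite (exprM _ 2 2) (le_trans (lerXn2r 2 _ _ h1)) ?nnegrE ?exprn_ge0//.
apply: le_trans h2 _; apply: le_trans (circ_mean_sq_le _ _) _.
rewrite ler_piMr ?invr_ge0//.
apply: le_trans (ler_wpM2l _ (normM_le _ _)) _ => //.
rewrite -[leRHS](@mulfV _ 2)// ler_wpM2l//.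
rewrite -[leRHS]mulr1 ler_pM// (le_trans k_le)// invf_le1// ler1n//.
Qed.

End selfadjoint.

(** A small positive multiple k of a a^* falls under the preceding estimates,
    and e is the mean [circ_mean k n] for n large. *)
Theorem approximate_unit P a (d : R[i]) : 0 < d -> subalgebra P ->
  P (a ** star a) -> exists e, [/\ P e, cocontraction e & `|a - e ** a| <= d].
Proof.
move=> d0 sP Paa; set z := a ** star a.
(* the scalar that brings the norm of z below 1/2 *)
pose c : R[i] := (2 * (`|z| + 1))^-1.
have z1 : 0 < `|z| + 1 by rewrite ltr_wpDl.
have c0 : 0 < c by rewrite invr_gt0 mulr_gt0.
pose k := c *: z.
have zz : star z = z by rewrite /z starM starK.
have kk : star k = k by rewrite /k starZ zz conj_Creal// gtr0_real.
have k_le : `|k| <= 2^-1.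
  rewrite /k normrZ gtr0_norm// /c invfM -mulrA ler_piMr ?invr_ge0//.
  by rewrite ler_pdivrMl// mulr1 lerDl.
have Pk : P k by exact: subalgebraZ.
(* |k - e k|^4 <= 1/(n+1) and |a - e a|^2 <= c^-1 |k - e k| *)
have cd : 0 < (c * d ^+ 2) ^+ 4 by rewrite exprn_gt0// mulr_gt0// exprn_gt0.
have [n nd] := complex_archimedean cd.
exists (circ_mean k n); split; first exact: subalgebra_circ_mean.
  exact: cocontraction_circ_mean.
set e := circ_mean k n.
have ce : cocontraction e by exact: cocontraction_circ_mean.
have ke : `|k - e ** k| <= c * d ^+ 2.
  rewrite -(@ler_pXn2r _ 4) ?nnegrE ?mulr_ge0 ?exprn_ge0 ?(ltW c0) ?(ltW d0)//.
  exact: le_trans (circ_mean_pow4_le kk k_le n) (ltW nd).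
rewrite -(@ler_pXn2r _ 2) ?nnegrE ?(ltW d0)//.
apply: le_trans (cocontraction_sq_le a ce) _; rewrite -/z.
by move: ke; rewrite /k smulZr -scalerBr normrZ gtr0_norm// ler_pM2l.
Qed.

End approximate_units.

(** * Closed subspaces and approximate units *)

Section closed_sets.
Context {R : realType} {A : cStarAlgType R}.
Implicit Types (a b e x y z : A) (C P : set A).

Lemma closed_mem_of_smul P C x : subalgebra P -> P (x ** star x) -> closed C ->
  (forall e, P e -> C (e ** x)) -> C x.
Proof.
move=> sP Px cC Cx; apply: closed_approx => // d d0.
have [e [Pe _ ed]] := approximate_unit d0 sP Px.
by exists (e ** x); first exact: Cx.
Qed.

Lemma closed_mem_of_smull C x : closed C -> (forall e, C (e ** x)) -> C x.
Proof.
by move=> cC Cx; apply: (@closed_mem_of_smul setT) => //; split.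
Qed.

Lemma closed_mem_of_smulr C x : closed C -> (forall e, C (x ** e)) -> C x.
Proof.
move=> cC Cx; apply: closed_approx => // d d0.
have sT : subalgebra [set: A] by split.
have [e [_ _ ed]] := @approximate_unit _ _ setT (star x) _ d0 sT I.
exists (x ** star e); first exact: Cx.
by rewrite -norm_star starB starM starK.
Qed.

(** The z for which some (1 - e) z with e in P is small.  Starting from an
    arbitrary (1 - e0) z makes this a linear condition: the contraction for a
    sum x + y is a composite, chosen for x first and then for (1 - e1) y. *)
Definition vanishing P z := forall e0 d, P e0 -> cocontraction e0 -> 0 < d ->
  exists e, [/\ P e, cocontraction e
    & `|z - e0 ** z - e ** (z - e0 ** z)| <= d].

Lemma sub_smul_linear e (c : R[i]) x y :
  c *: x + y - e ** (c *: x + y) = c *: (x - e ** x) + (y - e ** y).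
Proof. by rewrite smul_linearr opprD addrACA scalerBr. Qed.

Lemma vanishing0 P : subalgebra P -> vanishing P 0.
Proof.
move=> [P0 _ _] e0 d _ _ d0; exists 0; split => //; first exact: cocontraction0.
by rewrite smul0l smul0r !subr0 normr0 ltW.
Qed.

Lemma vanishing_linear P (c : R[i]) x y : subalgebra P ->
  vanishing P x -> vanishing P y -> vanishing P (c *: x + y).
Proof.
move=> sP vx vy e0 d Pe0 ce0 d0.
have c1 : 0 < 2 * (`|c| + 1) by rewrite mulr_gt0// ltr_wpDl.
have [e1 [Pe1 ce1 xd]] := vx e0 _ Pe0 ce0 (divr_gt0 d0 c1).
have [e2 [Pe2 ce2 yd]] := vy (circ e1 e0) _ (subalgebra_circ sP Pe1 Pe0)
  (cocontraction_circ ce1 ce0) (divr_gt0 d0 (ltr0n _ 2)).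
exists (circ e2 e1); split; [exact: subalgebra_circ|exact: cocontraction_circ|].
rewrite sub_circ in yd; rewrite sub_circ !sub_smul_linear.
rewrite (le_trans (ler_normD _ _))// [leRHS]splitr lerD// normrZ.
rewrite (le_trans (ler_wpM2l _ (ce2 _)))// (le_trans (ler_wpM2l _ xd))//.
rewrite invfM [d * _]mulrA mulrCA ler_piMr ?divr_ge0 ?(ltW d0)//.
by rewrite ler_pdivrMr ?ltr_wpDl// mul1r lerDl.
Qed.

Lemma vanishing_closed P : closed (vanishing P).
Proof.
apply: closed_of_approx => x xP e0 d Pe0 ce0 d0.
have d3 : 0 < d / 2 by rewrite divr_gt0.
have [y vy xy] := xP _ d3; have [e [Pe ce ye]] := vy e0 _ Pe0 ce0 d3.
exists e; split => //; rewrite -[x](subrK y).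
have := sub_smul_linear e0 1 (x - y) y; rewrite !scale1r => ->.
have := sub_smul_linear e 1 (x - y - e0 ** (x - y)) (y - e0 ** y).
rewrite !scale1r => ->.
rewrite (le_trans (ler_normD _ _))// [leRHS]splitr lerD//.
by rewrite (le_trans (ce _))// (le_trans (ce0 _)).
Qed.

(** For z = a b with a in P, (1 - e0) a is again in P, and an approximate unit
    for it makes z vanish; such z generate. *)
Lemma closed_span_vanishing P : subalgebra P ->
  (forall x, P x -> P (x ** star x)) ->
  closed_span [set a ** b | a in P & b in setT] `<=` vanishing P.
Proof.
move=> sP Pxx; have [_ _ PM] := sP; apply: closed_span_min.
- move=> _ [a Pa [b _ <-]] e0 d Pe0 ce0 d0.
  have b1 : 0 < `|b| + 1 by rewrite ltr_wpDl.
  have Pa0 : P (a - e0 ** a) by apply: subalgebraB => //; exact: PM.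
  have [e [Pe ce ed]] := approximate_unit (divr_gt0 d0 b1) sP (Pxx _ Pa0).
  exists e; split => //.
  have h u v : u ** b - v ** (u ** b) = (u - v ** u) ** b.
    by rewrite smulBl smulA.
  rewrite !h (le_trans (normM_le _ _))// (le_trans (ler_wpM2r _ ed))//.
  by rewrite mulrAC ler_pdivrMr// ler_pM2l// lerDl.
- exact: vanishing_closed.
- exact: vanishing0.
- by move=> c x y; exact: vanishing_linear.
Qed.

End closed_sets.

(** * Continuity of *-homomorphisms *)

Lemma cvg_geometric_steps (R : realType) (V : completeNormedModType R[i])
    (u : nat -> V) : (forall n, `|u n.+1 - u n| <= 2^-1 ^+ n) -> cvg (u @ \oo).
Proof.
move=> uh.
have dist n m : `|u (n + m)%N - u n| <= 2^-1 ^+ n * (2 * (1 - 2^-1 ^+ m)).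
  elim: m => [|m IH]; first by rewrite addn0 !subrr normr0 !mulr0.
  rewrite addnS -[u _.+1](subrK (u (n + m)%N)) -addrA.
  rewrite (le_trans (ler_normD _ _))// (le_trans (lerD (uh _) IH))//.
  rewrite exprD -mulrDr ler_wpM2l ?exprn_ge0 ?invr_ge0//.
  rewrite [_ ^+ m.+1]exprS !mulrBr !mulr1 mulrA mulfV// mul1r.
  rewrite addrCA lerD2l mulr_natl mulr2n opprD addrA subrr.
  by rewrite sub0r.
apply: cauchy_cvg; apply/cauchyP => e e0.
have [n ne] := complex_archimedean (divr_gt0 e0 (ltr0n _ 2)).
exists (u n); exists n => // m /= nm.
rewrite -ball_normE /ball_/= distrC -(subnKC nm).
apply: le_lt_trans (dist _ _) _; rewrite -[ltRHS](@divfK _ 2)//.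
apply: le_lt_trans (_ : 2^-1 ^+ n * 2 < _).
  rewrite ler_wpM2l ?exprn_ge0 ?invr_ge0//.
  by rewrite ler_piMr// gerBl exprn_ge0// invr_ge0.
by rewrite ltr_pM2r//; apply: le_lt_trans (half_pow_le _) _.
Qed.

Section square_roots.
Context {R : realType} {A : cStarAlgType R}.
Implicit Types (k s x y : A).

(** 1 - s is the square root of 1 - k^2, that is, s is the fixed point of
    s |-> (k^2 + s^2) / 2, which is a contraction of ratio 1/2 on the ball of
    radius 1/2.  The iterates from 0 are polynomials in k, whence self-adjoint
    and commuting with k. *)
Lemma square_root_complement k : star k = k -> `|k| <= 2^-1 -> exists s,
  [/\ star s = s, s ** k = k ** s & s + s = k ** k + s ** s].
Proof.
move=> kk kh; have h0 : 0 <= 2^-1 :> R[i] by rewrite invr_ge0.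
pose F s := 2^-1 *: (k ** k + s ** s).
have FB s t : F s - F t = 2^-1 *: (s ** (s - t) + (s - t) ** t).
  by rewrite /F -scalerBr opprD addrACA subrr add0r smulBr smulBl addrA subrK.
pose s n := iter n F 0.
have s_le n : `|s n| <= 2^-1.
  elim: n => [|n IH]; first by rewrite normr0.
  rewrite normrZ ger0_norm// ler_piMr// (le_trans (ler_normD _ _))//.
  rewrite [leRHS]splitr lerD// (le_trans (normM_le _ _))// mul1r.
    by rewrite -[leRHS]mulr1 ler_pM// (le_trans kh)// invf_le1// ler1n.
  by rewrite -[leRHS]mulr1 ler_pM// (le_trans IH)// invf_le1// ler1n.
have s_star n : star (s n) = s n.
  elim: n => [|n IH]; first exact: star0.
  by rewrite /= /F starZ starD !starM IH kk geC0_conj.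
have s_comm n : s n ** k = k ** s n.
  elim: n => [|n IH]; first by rewrite smul0l smul0r.
  by rewrite /= /F smulZl smulZr smulDl smulDr -!smulA IH !smulA IH.
have : cvg (s @ \oo).
  apply: cvg_geometric_steps => n; elim: n => [|n IH].
    rewrite subr0 expr0 (le_trans (s_le 1))// invf_le1// ler1n//.
  rewrite -[s n.+2]/(F (s n.+1)) -[X in _ - X]/(F (s n)) FB exprS.
  rewrite normrZ ger0_norm// ler_wpM2l// (le_trans (ler_normD _ _))//.
  rewrite [leRHS]splitr lerD// (le_trans (normM_le _ _))//.
    by rewrite mulrC ler_pM.
  by rewrite ler_pM.
move=> /cvg_ex[l sl]; exists l.
have lP e : 0 < e -> exists n, `|l - s n| <= e /\ `|l - s n.+1| <= e.
  move=> e0; have /cvgrPdist_le/(_ e e0)[N _ Nl] := sl.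
  by exists N; split; apply: Nl => /=.
have eq0 (x : A) c : 0 <= c -> (forall e, 0 < e -> `|x| <= e * c) -> x = 0.
  move=> c0 xc; apply/eqP; rewrite -normr_le0; apply/ler_addgt0Pr => e e0.
  have c1 : 0 < c + 1 by rewrite ltr_wpDl.
  rewrite add0r (le_trans (xc _ (divr_gt0 e0 c1)))// mulrAC ler_pdivrMr//.
  by rewrite ler_pM2l// lerDl.
split.
- apply/subr0_eq/(eq0 _ 2) => // e /lP[n [ln _]].
  rewrite -[X in X - _](subrK (s n)) -addrA (le_trans (ler_normD _ _))//.
  rewrite mulr_natr mulr2n lerD// distrC//.
  by rewrite -{1}[s n]s_star -starB norm_star distrC.
- apply/subr0_eq/(eq0 _ (2 * `|k|)); first exact: mulr_ge0.
  move=> e /lP[n [ln _]].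
  have -> : l ** k - k ** l = (l - s n) ** k - k ** (l - s n).
    by rewrite smulBl smulBr s_comm opprB addrA subrK.
  rewrite (le_trans (ler_normB _ _))// mulrCA mulr_natl mulr2n lerD//.
    by rewrite (le_trans (normM_le _ _))// ler_wpM2r.
  by rewrite (le_trans (normM_le _ _))// mulrC ler_wpM2r.
- have Fl : l = F l.
    apply/subr0_eq/(eq0 _ (1 + 2^-1 * (2^-1 + `|l|))).
      by rewrite addr_ge0// mulr_ge0// addr_ge0.
    move=> e /lP[n [ln ln1]].
    rewrite -[X in X - _](subrK (s n.+1)) -addrA (le_trans (ler_normD _ _))//.
    rewrite mulrDr mulr1 lerD// -[X in X - _]/(F (s n)) FB normrZ ger0_norm//.
    rewrite mulrCA ler_wpM2l// mulrDr (le_trans (ler_normD _ _))//.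
    rewrite distrC in ln.
    rewrite lerD// (le_trans (normM_le _ _))//.
      by rewrite mulrC ler_pM.
    by rewrite ler_wpM2r.
  rewrite {1 2}Fl /F -scalerDl -[X in X + _]mul1r -[X in _ + X]mul1r.
  by rewrite -splitr scale1r.
Qed.

End square_roots.

Section automatic_continuity.
Context {R : realType}.

(** u = f + i g satisfies u' u = u u' = f^2 + g^2 = 1 for its adjoint u', so u
    and u' are isometries and 2 f = u + u'. *)
Lemma norm_le_of_sq_add (B : cStarAlgType R) (f g : B -> B) :
  adjoint f f -> adjoint g g -> linear f -> linear g ->
  (forall x, f (g x) = g (f x)) -> (forall x, f (f x) + g (g x) = x) ->
  forall x, `|f x| <= `|x|.
Proof.
move=> ff gg lf lg fg fg1 x.
pose u y := f y + 'i *: g y; pose u' y := f y + 'i^* *: g y.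
have uu : adjoint u u' by apply: adjoint_add => //; exact: adjoint_scale.
have u'u : adjoint u' u.
  have -> : u = fun y => f y + ('i^*)^* *: g y.
    by apply/funext => y; rewrite conjCK.
  by apply: adjoint_add => //; exact: adjoint_scale.
have iC : 'i^* = - 'i :> R[i] by exact: conjCi.
have ii : 'i * 'i = -1 :> R[i] by rewrite -expr2 sqrCi.
have idid : adjoint (@id B) id by [].
have e1 : `|u x| = `|x|.
  apply: (norm_eq_adjoint uu idid); rewrite /u /u' /=.
  rewrite (linear_addr _ _ _ lf) (linear_addr _ _ _ lg) scalerDr scalerA iC.
  by rewrite mulNr ii opprK scale1r scaleNr fg addrA addrK fg1.
have e2 : `|u' x| = `|x|.
  apply: (norm_eq_adjoint u'u idid); rewrite /u /u' /=.
  rewrite (linear_addr _ _ _ lf) (linear_addr _ _ _ lg) scalerDr scalerA iC.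
  by rewrite mulrN ii opprK scale1r scaleNr fg addrA subrK fg1.
rewrite -(@ler_pM2l _ 2)//.
have -> : 2 * `|f x| = `|u x + u' x|.
  by rewrite /u /u' iC scaleNr addrACA subrr addr0 -mulr2n normrMn mulr_natl.
by rewrite (le_trans (ler_normD _ _))// e1 e2 mulr_natl mulr2n.
Qed.

Variables (A B : cStarAlgType R) (phi : starHom A (multiplier B)).

Lemma lact_starHom_linear b : linear (fun a => lact (phi a) b).
Proof. by move=> c x y; rewrite /= starHom_linear. Qed.

Lemma lact_starHomM x y b :
  lact (phi (x ** y)) b = lact (phi x) (lact (phi y) b).
Proof. by rewrite starHomM. Qed.

Lemma ract_starHomM x y b :
  ract (phi (x ** y)) b = ract (phi y) (ract (phi x) b).
Proof. by rewrite starHomM. Qed.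

Lemma ract_starHom x b : ract (phi x) b = star (lact (phi (star x)) (star b)).
Proof. by rewrite starHom_star /= !starK. Qed.

Lemma lact_starHomD x y b :
  lact (phi (x + y)) b = lact (phi x) b + lact (phi y) b.
Proof. by have := lact_starHom_linear b 1 x y; rewrite !scale1r. Qed.

Lemma lact_subr m x y : lact m (x - y) = lact m x - lact m y :> B.
Proof. by rewrite addrC -scaleN1r lact_linear scaleN1r addrC. Qed.

(** The identity k^2 + (1 - s)^2 = 1 for k = a^* a involves only the algebra
    operations once expanded, so it holds for the images under phi; and
    |phi(a) b|^2 <= |b| |phi(k) b|. *)
Lemma norm_lact_starHom_le a :
  `|a| <= 2^-1 -> forall b, `|lact (phi a) b| <= `|b|.
Proof.
move=> ah b; have adj x : adjoint (lact (phi x)) (lact (phi (star x))).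
  by move=> y z; rewrite adjoint_lact starHom_star.
pose k := star a ** a.
have kk : star k = k by rewrite /k starM starK.
have kh : `|k| <= 2^-1.
  rewrite cstar_identity expr2 (le_trans _ ah)// ler_piMr//.
  by rewrite (le_trans ah)// invf_le1// ler1n.
have [s [ss sk sq]] := square_root_complement kk kh.
have kb : `|lact (phi k) b| <= `|b|.
  apply: (@norm_le_of_sq_add _ _ (fun y => y - lact (phi s) y)).
  - by have := adj k; rewrite kk.
  - move=> x y; rewrite starB smulBl smulBr; congr (_ - _).
    by have := adj s; rewrite ss; exact.
  - exact: lact_linear.
  - by move=> c x y; rewrite lact_linear opprD addrACA scalerBr.
  - move=> x; by rewrite lact_subr -!lact_starHomM sk.
  - move=> x; rewrite lact_subr opprB addrACA -opprD -lact_starHomD sq.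
    rewrite lact_starHomD !lact_starHomM addrA [x + _]addrC addrA.
    by rewrite [_ + x]addrC addrK.
rewrite -(@ler_pXn2r _ 2) ?nnegrE//.
apply: le_trans (norm_sq_le_adjoint b (adj a)) _.
by rewrite -lact_starHomM expr2 ler_wpM2l.
Qed.

Lemma lact_starHomB x y b :
  lact (phi (x - y)) b = lact (phi x) b - lact (phi y) b.
Proof.
by have := lact_starHom_linear b (-1) y x; rewrite !scaleN1r ![- _ + _]addrC.
Qed.

Lemma lact_starHomZ c x b : lact (phi (c *: x)) b = c *: lact (phi x) b.
Proof.
have phi0 : lact (phi 0) b = 0 by rewrite -(subrr 0) lact_starHomB subrr.
by have := lact_starHom_linear b c x 0; rewrite !addr0 phi0 addr0.
Qed.

Lemma lact_starHom_continuous b : continuous (fun a => lact (phi a) b).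
Proof.
move=> a; apply/cvgrPdist_le => e e0.
pose d := e / (`|b| + 1); have b1 : 0 < `|b| + 1 by rewrite ltr_wpDl.
have d0 : 0 < d by rewrite divr_gt0.
near=> x; rewrite -lact_starHomB -[a - x](@scalerK _ _ d) ?gt_eqF//.
rewrite [_^-1 *: _]scalerA mulrC -scalerA lact_starHomZ normrZ gtr0_norm//.
apply: le_trans (ler_wpM2l (ltW d0) (norm_lact_starHom_le _ _)) _.
  rewrite normrZ normfV gtr0_norm// ler_pdivrMl//.
  near: x; apply: cvgr_dist_le => //; exact: divr_gt0.
by rewrite /d mulrAC ler_pdivrMr// ler_pM2l// lerDl.
Unshelve. all: by end_near. Qed.

Lemma ract_starHom_continuous b : continuous (fun a => ract (phi a) b).
Proof.
have -> : (fun a => ract (phi a) b) =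
    star \o (fun a => lact (phi a) (star b)) \o star.
  by apply/funext => a; exact: ract_starHom.
move=> a; apply: continuous_comp; first exact: star_continuous.
apply: continuous_comp; first exact: lact_starHom_continuous.
exact: star_continuous.
Qed.

End automatic_continuity.

(** * Restriction and induction of ideals *)

Lemma closed_span_image (R : realType) (A B : cStarAlgType R) (f : A -> B)
    (X : set A) (C : set B) :
  continuous f -> linear f -> closed C -> C 0 ->
  (forall (k : R[i]) x y, C x -> C y -> C (k *: x + y)) ->
  (forall x, X x -> C (f x)) -> forall x, closed_span X x -> C (f x).
Proof.
move=> cf lf cC C0 Cl XC; rewrite -[forall x, _]/(closed_span X `<=` f @^-1` C).
apply: closed_span_min => //.
- by apply: preimage_closed => // x _; exact: cf.
- have f0 : f 0 = 0.
    by have := lf (-1) 0 0; rewrite scaler0 addr0 scaleN1r addNr.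
  by rewrite /preimage/= f0.
- by move=> k x y Cx Cy; rewrite /preimage/= lf; exact: Cl.
Qed.

Section ideal_theory.
Context {R : realType} {B : cStarAlgType R}.
Implicit Types (J K : set B) (m : multiplier B) (x y z : B).

Lemma subalgebra_ideal J : ideal J -> subalgebra J.
Proof. by move=> [_ J0 Jl Ja]; split => // x y _ Jy; have [] := Ja x y Jy. Qed.

(** Ideals of B are ideals of M(B): (z m) e = z (m e) is in J for all e in B,
    and an approximate unit of B removes e. *)
Lemma ideal_ract J m z : ideal J -> J z -> J (ract m z).
Proof.
move=> [cJ _ _ Ja] Jz; apply: closed_mem_of_smulr => // e.
by rewrite -lractM; have [] := Ja (lact m e) z Jz.
Qed.

Lemma ideal_lact J m z : ideal J -> J z -> J (lact m z).
Proof.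
move=> [cJ _ _ Ja] Jz; apply: closed_mem_of_smull => // e.
by rewrite lractM; have [] := Ja (ract m e) z Jz.
Qed.

(** x is a limit of products e x with e in J; so the intersection of two ideals
    is the closed span of their product. *)
Lemma ideal_mem_of_smul J C x : ideal J -> J x -> closed C ->
  (forall e, J e -> C (e ** x)) -> C x.
Proof.
move=> iJ Jx; apply: closed_mem_of_smul; first exact: subalgebra_ideal.
by have [_ _ _ /(_ (star x) x Jx)[]] := iJ.
Qed.

End ideal_theory.

Lemma idealI (R : realType) (A : cStarAlgType R) (I J : set A) :
  ideal I -> ideal J -> ideal (I `&` J).
Proof.
move=> [cI I0 Il Ia] [cJ J0 Jl Ja]; split=> //; first exact: closedI.
  by move=> k x y [Ix Jx] [Iy Jy]; split; [exact: Il|exact: Jl].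
by move=> a x [/(Ia a)[? ?] /(Ja a)[? ?]].
Qed.

Section restriction_induction.
Context {R : realType} {A B : cStarAlgType R}.
Variable phi : starHom A (multiplier B).
Implicit Types (I : set A) (J K : set B).

Lemma restrictionP J a : ideal J -> restriction phi J a <->
  forall b, J (lact (phi a) b) /\ J (ract (phi a) b).
Proof.
move=> [cJ J0 Jl _].
have lact0 m : lact m 0 = 0 :> B.
  by rewrite -[X in lact m X](subrr 0) lact_subr subrr.
have ract0 m : ract m 0 = 0 :> B.
  by have := ract_linear m (-1) 0 0; rewrite scaler0 addr0 scaleN1r addNr.
split=> [Ja b|Ja _ [b _ [c _ <-]]].
  split; apply: Ja.
    by exists b => //; exists 0 => //; rewrite ract0 addr0.
  by exists 0 => //; exists b => //; rewrite lact0 add0r.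
by rewrite -[lact _ _]scale1r; apply: Jl; [have [] := Ja b|have [] := Ja c].
Qed.

Lemma ideal_restriction J : ideal J -> ideal (restriction phi J).
Proof.
move=> iJ; have [cJ J0 Jl _] := iJ.
split.
- have -> : restriction phi J = \bigcap_b
      ((fun a => lact (phi a) b) @^-1` J `&` (fun a => ract (phi a) b) @^-1` J).
    apply/seteqP; split=> a; first by move/restrictionP => Ja b _; exact: Ja.
    by move=> Ja; apply/restrictionP => // b; exact: Ja.
  apply: closed_bigI => b _; apply: closedI; apply: preimage_closed => // a _.
    exact: lact_starHom_continuous.
  exact: ract_starHom_continuous.
- apply/restrictionP => // b.
  have h : lact (phi 0) b = 0 /\ ract (phi 0) b = 0.
    have := @starHom_linear _ _ _ phi (-1) 0 0.
    by rewrite scaler0 addr0 scaleN1r addNr => ->.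
  by case: h => -> ->.
- move=> k x y /(restrictionP _ iJ) Jx /(restrictionP _ iJ) Jy.
  apply/restrictionP => // b; rewrite starHom_linear /=.
  have [? ?] := Jx b; have [? ?] := Jy b.
  by split; apply: Jl.
- move=> a x /(restrictionP _ iJ) Jx; split; apply/restrictionP => // b;
  rewrite lact_starHomM ract_starHomM; have [J1 J2] := Jx b.
  + split; first by apply: ideal_lact.
    by have [] := Jx (ract (phi a) b).
  + split; last by apply: ideal_ract.
    by have [] := Jx (lact (phi a) b).
Qed.

Lemma mem_induction I a b : I a ->
  induction phi I (lact (phi a) b) /\ induction phi I (ract (phi a) b).
Proof.
move=> Ia; split.
  apply: (@closed_mem_of_smull _ _ (induction phi I)).
    exact: closed_closure.
  by move=> e; apply: sub_closed_span; exists e, a, b.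
apply: (@closed_mem_of_smulr _ _ (induction phi I)).
  exact: closed_closure.
by move=> e; rewrite -lractM; apply: sub_closed_span; exists b, a, e.
Qed.

Lemma induction_min I J : ideal J -> I `<=` restriction phi J ->
  induction phi I `<=` J.
Proof.
move=> iJ IJ; have [cJ J0 Jl Ja] := iJ.
apply: closed_span_min => // _ [b [a [c [Ia ->]]]].
have [Jac _] := (restrictionP a iJ).1 (IJ _ Ia) c.
by have [] := Ja b _ Jac.
Qed.

Lemma sub_restriction_induction I : ideal I ->
  I `<=` restriction phi (induction phi I).
Proof.
move=> iI a Ia; apply/restrictionP; first exact: ideal_induction.
by move=> b; exact: mem_induction.
Qed.

Lemma inductionS I I' : I `<=` I' -> induction phi I `<=` induction phi I'.
Proof.
move=> II'; apply: closed_span_min.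
- move=> _ [b [a [c [Ia ->]]]]; apply: sub_closed_span.
  by exists b, a, c; split=> //; exact: II'.
- exact: closed_closure.
- exact: closed_span0.
- exact: closed_span_linear.
Qed.

Lemma restrictionS J K : J `<=` K -> restriction phi J `<=` restriction phi K.
Proof. by move=> JK a Ja x /Ja /JK. Qed.

Lemma restriction_induction_restriction I : restricted phi I ->
  restriction phi (induction phi I) `<=` I.
Proof.
by move=> [J iJ <-]; apply: restrictionS; exact: induction_min.
Qed.

Lemma ideal_restricted I : restricted phi I -> ideal I.
Proof. by move=> [J iJ <-]; exact: ideal_restriction. Qed.

Lemma induction_restriction_induction I : ideal I ->
  induction phi (restriction phi (induction phi I)) = induction phi I.
Proof.
move=> iI; apply/seteqP; split.
  by apply: induction_min => //; exact: ideal_induction.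
by apply: inductionS; exact: sub_restriction_induction.
Qed.

(** The step where symmetry enters: phi(a) (c b') is a limit of sums of terms
    e phi(d) with d in I, and phi(d) phi(a') = phi(d a') with d a' in both
    ideals. *)
Lemma induction_smul I I' x y : ideal I -> ideal I' -> symmetric_ideal phi I ->
  induction phi I x -> induction phi I' y ->
  induction phi (I `&` I') (x ** y).
Proof.
move=> [_ _ _ Ia] [_ _ _ Ia'] symI Ix Iy.
set C := induction phi (I `&` I').
have C0 : C 0 by exact: closed_span0.
have Cl (k : R[i]) u v : C u -> C v -> C (k *: u + v).
  exact: closed_span_linear.
have cC : closed C by exact: closed_closure.
apply: (closed_span_image (f := smul^~ y) (C := C) _ _ _ _ _ _ Ix) => //.
- exact: smulr_continuous.
- by move=> k u v; rewrite smul_linearl.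
move=> _ [b [a [c [aI ->]]]].
apply: (closed_span_image (f := smul (b ** lact (phi a) c)) (C := C)
  _ _ _ _ _ _ Iy) => //.
- exact: smull_continuous.
- by move=> k u v; rewrite smul_linearr.
move=> _ [b' [a' [c' [aI' ->]]]].
rewrite smulA -[_ ** b']smulA -lactM.
have aIB : closed_span [set ract (phi a) b | a in I & b in setT]
    (lact (phi a) (c ** b')).
  by rewrite -symI; apply: sub_closed_span; exists a => //; exists (c ** b').
apply: (closed_span_image (f := fun z => b ** z ** lact (phi a') c') (C := C)
  _ _ _ _ _ _ aIB) => //.
- move=> z.
  apply: (@continuous_comp _ _ _ (smul b) (smul^~ (lact (phi a') c'))).
    exact: smull_continuous.
  exact: smulr_continuous.
- by move=> k u v; rewrite smul_linearr smul_linearl.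
move=> _ [d dI [e _ <-]]; rewrite -smulA -lractM -lact_starHomM smulA.
apply: sub_closed_span; exists (b ** e), (d ** a'), c'; split=> //; split.
  by have [] := Ia a' d dI.
by have [] := Ia' d a' aI'.
Qed.

Lemma capI_sub_induction I I' : ideal I -> ideal I' -> symmetric_ideal phi I ->
  induction phi I `&` induction phi I' `<=` induction phi (I `&` I').
Proof.
move=> iI iI' sI x [xI xI'].
apply: (ideal_mem_of_smul (ideal_induction phi iI) xI).
  exact: closed_closure.
by move=> e eI; exact: induction_smul.
Qed.

Lemma symmetric_FR1 : symmetric_hom phi -> cond_FR1 phi.
Proof.
move=> sym I J rI iJ; have iI := ideal_restricted rI.
apply/seteqP; split=> [a ha|a [Ia Ja]].
  split; [apply: restriction_induction_restriction => //|];
    by apply: restrictionS ha; apply: inductionS => ? [].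
apply/restrictionP; first by apply: ideal_induction; exact: idealI.
move/(restrictionP a (ideal_induction phi iJ)) : Ja => Ja b.
have [Jl Jr] := Ja b; have [Il Ir] := mem_induction b Ia.
by split; apply: capI_sub_induction => //; exact: sym.
Qed.

(** The first ideal may be replaced by r(i(I)), which induces the same ideal
    and is symmetric, being restricted. *)
Lemma symmetric_inducedI K K' : symmetric_hom phi ->
  Defs.induced phi K -> Defs.induced phi K' -> Defs.induced phi (K `&` K').
Proof.
move=> sym [I iI <-] [I' iI' <-].
pose I1 := restriction phi (induction phi I).
have rI1 : restricted phi I1.
  by exists (induction phi I) => //; exact: ideal_induction.
have iI1 := ideal_restricted rI1.
exists (I1 `&` I'); first exact: idealI.
rewrite -(induction_restriction_induction iI) -/I1.
apply/seteqP; split; last by apply: capI_sub_induction => //; exact: sym.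
by move=> x Ix; split; apply: inductionS Ix => ? [].
Qed.

Lemma symmetric_MIf : symmetric_hom phi -> cond_MIf phi.
Proof.
move=> sym F /finite_seqP[s ->]; elim: s => [[?//]|K s IH _ indF].
have -> : [set` K :: s] = K |` [set` s].
  apply/seteqP; split=> L /=; rewrite in_cons.
    by move=> /orP[/eqP ->|]; [left|right].
  by move=> [->|->]; rewrite ?eqxx ?orbT.
rewrite bigcap_setU1.
have indK : Defs.induced phi K by apply: indF; rewrite /= mem_head.
have [->|s0] := eqVneq s [::]; first by rewrite set_nil bigcap_set0 setIT.
apply: symmetric_inducedI => //; apply: IH; last first.
  by move=> L /= Ls; apply: indF; rewrite /= in_cons Ls orbT.
by apply/set0P; rewrite set_seq_eq0.
Qed.

End restriction_induction.

(** * Symmetric inclusions *)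

Section symmetric_inclusions.
Context {R : realType} {B : cStarAlgType R} (S : cStarSubalg B).
Local Notation A := (subalg S).
Implicit Types I : set A.

(** If a is in the closed span of I B, then (1 - e) a is small for some e in I,
    and e a is in I. *)
Lemma subalg_mem_closed_span I (a : A) : ideal I ->
  closed_span [set lact (inclusion S x) b | x in I & b in setT] (val a) -> I a.
Proof.
move=> [cI I0 Il Ia] aL; pose P := [set val x | x in I].
have sP : subalgebra P.
  split; first by exists 0.
    move=> c _ _ [x Ix <-] [y Iy <-]; exists (c *: x + y); first exact: Il.
    exact: (starHom_linear (subalg_incl S)).
  move=> _ _ [x Ix <-] [y Iy <-]; exists (x ** y) => //.
  by have [] := Ia x y Iy.
have Pxx x : P x -> P (x ** star x).
  move=> [y Iy <-]; exists (y ** star y) => //; by have [] := Ia (star y) y Iy.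
have aP : closed_span [set x ** b | x in P & b in setT] (val a).
  apply: closed_span_min aL.
  - move=> _ [x Ix [b _ <-]]; apply: sub_closed_span.
    by exists (val x); [exists x|exists b].
  - exact: closed_closure.
  - exact: closed_span0.
  - exact: closed_span_linear.
have [P0 _ _] := sP; apply: closed_approx => // d d0.
have [e [[x Ix <-] _ ed]] :=
  closed_span_vanishing sP Pxx aP P0 (@cocontraction0 _ _) d0.
exists (x ** a); first by have [] := Ia a x Ix.
by move: ed; rewrite smul0l subr0.
Qed.

(** For the join I, r(i(I)) = I.  Since the closed span of B I is generated by
    the B I0 = I0 B with I0 in the family, it lies in the closed span L of I B,
    and so does i(I). *)
Lemma symmetric_inclusion_JR : symmetric_inclusion S -> cond_JR (inclusion S).
Proof.
move=> sym F Fr; set I := ideal_join F.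
have Fi : F `<=` @ideal R A by move=> I0 /Fr; exact: ideal_restricted.
have [iI FI _] := ideal_joinP Fi; rewrite -/I in iI FI.
have iJ := ideal_induction (inclusion S) iI.
exists (induction (inclusion S) I) => //.
apply/seteqP; split; last exact: sub_restriction_induction.
move=> a aJ; have ha := (restrictionP _ a iJ).1 aJ.
apply: subalg_mem_closed_span => //.
set L := closed_span _.
have cL : closed L by exact: closed_closure.
have L0 : L 0 by exact: closed_span0.
have Ll (k : R[i]) x y : L x -> L y -> L (k *: x + y).
  exact: closed_span_linear.
have aI : induction (inclusion S) I (val a).
  apply: (@closed_mem_of_smulr _ _ (induction _ I)) => [|e].
    exact: closed_closure.
  by have [] := ha e.
apply: closed_span_min aI => // _ [b [x [c [Ix ->]]]].
have Lc z : L z -> L (z ** c).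
  apply: (closed_span_image (f := smul^~ c) (C := L)) => //.
  - exact: smulr_continuous.
  - by move=> k u v; rewrite smul_linearl.
  move=> _ [y Iy [d _ <-]]; rewrite -lactM; apply: sub_closed_span.
  by exists y => //; exists (d ** c).
rewrite /= smulA; apply: Lc.
apply: (closed_span_image (f := fun x => ract (inclusion S x) b) (C := L)
  _ _ _ _ _ _ Ix) => //.
- exact: ract_starHom_continuous.
- by move=> k u v; rewrite starHom_linear.
move=> y [I0 FI0 I0y].
have : closed_span [set ract (inclusion S x) b | x in I0 & b in setT]
    (ract (inclusion S y) b).
  by apply: sub_closed_span; exists y => //; exists b.
rewrite -(sym I0 (Fr _ FI0)).
apply: closed_span_min => // _ [z I0z [d _ <-]]; apply: sub_closed_span.
by exists z; [exact: FI I0z|exists d].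
Qed.

End symmetric_inclusions.

Theorem corollary5p5 (R : realType) :
  (forall (B : cStarAlgType R) (A : cStarSubalg B),
     symmetric_inclusion A ->
     [/\ cond_JR (inclusion A), cond_FR1 (inclusion A)
       & cond_MIf (inclusion A)]) /\
  (forall (A B : cStarAlgType R) (phi : starHom A (multiplier B)),
     symmetric_hom phi -> cond_FR1 phi /\ cond_MIf phi).
Proof.
split=> [B A sym|A B phi sym].
  split; first exact: symmetric_inclusion_JR.
    exact: symmetric_FR1.
  exact: symmetric_MIf.
by split; [exact: symmetric_FR1|exact: symmetric_MIf].
Qed.
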